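(* Let $\alpha:I\to M$ be a null Cartan curve on a timelike hypersurface $M^3\subset\mathbb{E}^4_1$ with Darboux frame $\{T,\zeta,e,\eta\}$, let $W$ be a fixed vector written in the Darboux frame as $W=aT+b\zeta+ce+d\eta$, and let $\widetilde\eta=\eta+\lambda_1T+\lambda_2e$ be a generalized normal, with $\lambda_1,\lambda_2$ functions of $s$. Then $\alpha$ is a normal silhouette with axis $W$ if and only if $$\langle\eta,W\rangle+\varepsilon_1b\,\lambda_1+c\,\lambda_2=0 .$$ This is one linear equation in the two unknowns $(\lambda_1,\lambda_2)$ and always admits solutions whenever $c\neq0$. In particular, normal silhouettes always exist in $\mathbb{E}^4_1$, for variable curvatures.
   Context: Minkowski space-time $\mathbb{E}^4_1$ is $\mathbb{R}^4$ with the metric $\langle x,y\rangle=-x_1y_1+x_2y_2+x_3y_3+x_4y_4$. A null Cartan curve is a smooth null curve ($\alpha'\neq0$, $\langle\alpha',\alpha'\rangle=0$) parametrized by pseudo-arc length $s$, i.e. $\langle\alpha'',\alpha''\rangle=1$; $T=\alpha'$. A timelike hypersurface $M^3\subset\mathbb{E}^4_1$ is one with spacelike unit normal $\eta$, $\langle\eta,\eta\rangle=1$. Along $\alpha\subset M$, a Darboux frame $\{T,\zeta,e,\eta\}$ has $\zeta,e$ tangent to $M$ and satisfies $\langle T,T\rangle=\langle\zeta,\zeta\rangle=0$, $\langle T,\zeta\rangle=\varepsilon_1=\pm1$, $\langle e,e\rangle=\langle\eta,\eta\rangle=1$, all other inner products zero. The components $a,b,c,d$ of $W$ are functions of $s$.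 The generalized normal along $\alpha$ is $\widetilde\eta=\eta+\lambda_1(s)T+\lambda_2(s)e$; $\alpha$ is a normal silhouette with axis $W$ (for this choice of $\lambda_1,\lambda_2$) if $\langle\widetilde\eta,W\rangle=0$ for all $s$. ''Always exist, for variable curvatures'' means that, with no constancy assumption on the curvature functions of $\alpha$, the equation can be solved for $(\lambda_1,\lambda_2)$ when $c\neq0$. *)

(* Defs.v *)
From mathcomp Require Export all_boot all_order all_algebra.
From mathcomp Require Export all_classical all_reals all_analysis.
Export Order.TTheory GRing.Theory Num.Theory numFieldNormedType.Exports.

Set Implicit Arguments.
Unset Strict Implicit.
Unset Printing Implicit Defensive.

Local Open Scope ring_scope.
Local Open Scope classical_set_scope.

(* Points and vectors of E^4_1 are row vectors; the timelike coordinate x_1 is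
   [x 0 0]. *)
Definition mink (R : realType) (x y : 'rV[R]_4) : R :=
  - (x 0 0 * y 0 0) + \sum_(i < 4 | i != 0) x 0 i * y 0 i.

(* [f] is C^k on [U].  Functions are total, and only their values on [U]
   matter when [U] is open, which is the only case in which this is used. *)
Fixpoint Ck (R : realType) (V W : normedModType R) (k : nat) (U : set V)
    (f : V -> W) : Prop :=
  if k is k'.+1 then
    (forall x, U x -> differentiable f x) /\ (forall v, Ck k' U ('D_v f))
  else forall x, U x -> {for x, continuous f}.

Definition smooth (R : realType) (V W : normedModType R) (U : set V)
    (f : V -> W) : Prop := forall k, Ck k U f.

Definition open_interval (R : realType) (I : set R) : Prop :=
  [/\ open I, is_interval I & I !=set0].

(* Embedded smooth hypersurface of R^4: locally the zero set of a smooth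
   function with nonvanishing differential. *)
Definition hypersurface (R : realType) (M : set 'rV[R]_4) : Prop :=
  forall p, M p -> exists (U : set 'rV[R]_4) (F : 'rV[R]_4 -> R),
    [/\ open U, U p, smooth U F,
        forall x, U x -> (M x <-> F x = 0)
      & forall x, U x -> M x -> exists v, 'd F x v != 0].

Definition tangent (R : realType) (M : set 'rV[R]_4) (p v : 'rV[R]_4) : Prop :=
  exists (r : R) (g : R -> 'rV[R]_4),
    [/\ 0 < r, smooth `]-r, r[ g, forall t, -r < t < r -> M (g t),
        g 0 = p & derive1 g 0 = v].

Definition unit_normal (R : realType) (M : set 'rV[R]_4) (p n : 'rV[R]_4) :
    Prop :=
  mink n n = 1 /\ forall v, tangent M p v -> mink n v = 0.

Definition timelike_hypersurface (R : realType) (M : set 'rV[R]_4) : Prop :=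
  hypersurface M /\ forall p, M p -> exists n, unit_normal M p n.

Definition null_cartan_curve (R : realType) (I : set R) (alpha : R -> 'rV[R]_4) :
    Prop :=
  smooth I alpha /\ forall s, I s ->
    [/\ derive1 alpha s != 0, mink (derive1 alpha s) (derive1 alpha s) = 0
      & mink (derive1n 2 alpha s) (derive1n 2 alpha s) = 1].

(* The frame is {T, zeta, e, eta} with T = alpha'. *)
Record darboux_frame (R : realType) (M : set 'rV[R]_4) (I : set R)
    (alpha zeta e eta : R -> 'rV[R]_4) (eps1 : R) : Prop := DarbouxFrame {
  darboux_smooth : [/\ smooth I zeta, smooth I e & smooth I eta] ;
  darboux_tangent : forall s, I s ->
    tangent M (alpha s) (zeta s) /\ tangent M (alpha s) (e s) ;
  darboux_normal : forall s, I s -> unit_normal M (alpha s) (eta s) ;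
  darboux_sign : eps1 = 1 \/ eps1 = -1 ;
  darboux_null : forall s, I s ->
    mink (derive1 alpha s) (derive1 alpha s) = 0 /\ mink (zeta s) (zeta s) = 0 ;
  darboux_T_zeta : forall s, I s -> mink (derive1 alpha s) (zeta s) = eps1 ;
  darboux_unit : forall s, I s ->
    mink (e s) (e s) = 1 /\ mink (eta s) (eta s) = 1 ;
  darboux_orth : forall s, I s ->
    [/\ mink (derive1 alpha s) (e s) = 0, mink (derive1 alpha s) (eta s) = 0,
        mink (zeta s) (e s) = 0, mink (zeta s) (eta s) = 0
      & mink (e s) (eta s) = 0] }.

Definition generalized_normal (R : realType) (alpha e eta : R -> 'rV[R]_4)
    (l1 l2 : R -> R) (s : R) : 'rV[R]_4 :=
  eta s + l1 s *: derive1 alpha s + l2 s *: e s.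

Definition normal_silhouette (R : realType) (I : set R)
    (alpha e eta : R -> 'rV[R]_4) (l1 l2 : R -> R) (W : 'rV[R]_4) : Prop :=
  forall s, I s -> mink (generalized_normal alpha e eta l1 l2 s) W = 0.

(* Main.v *)
From HB Require Import structures.
Require Import Defs.

Set Implicit Arguments.
Unset Strict Implicit.
Unset Printing Implicit Defensive.

Local Open Scope ring_scope.
Local Open Scope classical_set_scope.

(** Expanding the bilinear Minkowski product, the silhouette condition
    [mink (eta + l1 T + l2 e) W = 0] reads
    [mink eta W + l1 * mink T W + l2 * mink e W = 0].  Since [T] is null and
    orthogonal to [e] and [eta], only the [zeta]-component of [W] contributes to
    [mink T W], which gives [mink T W = eps1 * b]; and [e] is a unit vector
    orthogonal to the three others, so that [mink e W = c] ([mink_T_frame],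
    [mink_e_frame]).  This is the stated linear equation.

    When [c] vanishes nowhere the pair [l1 = 0], [l2 = - mink eta W / c] solves
    it.  No regularity of [c] is assumed, but on the interval it coincides with
    [mink e W], and [eta], [e] are smooth while [W] is constant.  So [l2] is a
    quotient of two smooth functions with nonvanishing denominator.  What remains
    is that smoothness, defined through iterated directional derivatives of total
    functions, passes to images under continuous linear maps ([Ck_linear]),
    products ([Ck_mul]) and inverses ([Ck_inv]).  Each of these is an induction
    on the order, in which the derivative is computed by the usual rule on the
    open set only; [Ck_eq_on], the locality of smoothness, is what allows the
    derivative to be replaced there by its formula. *)

(** * Locality of differentiability *)

(** The differential of [f] satisfies the first-order expansion that
    characterizes the differential of [g], because the two remainders coincide
    near the point. *)
Lemma near_eq_differentiable (R : numFieldType) (V W : normedModType R)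
    (f g : V -> W) (x : V) :
  {near x, f =1 g} -> differentiable f x -> differentiable g x.
Proof.
move=> fg df.
have gx : g x = f x by rewrite (nbhs_singleton fg).
have dg : g \o shift x = cst (g x) + 'd f x +o_ 0 id.
  apply/eqaddoP => eps eps0.
  have /eqaddoP/(_ eps eps0) := diff_locally df.
  have fg0 : \forall h \near (0 : V), f (h + x) = g (h + x).
    have : {near 0 + x, f =1 g} by rewrite add0r.
    have /(_ 0) : continuous (fun h : V => h + x).
      by move=> h; apply: cvgD; [exact: cvg_id|exact: cvg_cst].
    by apply.
  apply: filterS2 fg0 => h /= fgh.
  by rewrite !fctE /= gx -fgh.
apply/diff_locallyP.
have dc : continuous ('d f x) by exact: diff_continuous.
by have -> := diff_unique dc dg.
Qed.

(** * Calculus of functions of class C^k *)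

Section CkCalculus.
Context {R : realType}.
Implicit Types V W : normedModType R.

(** Openness of [U] makes agreement on [U] an agreement near each of its points,
    hence passes to the directional derivatives. *)
Lemma Ck_eq_on V W k (U : set V) (f g : V -> W) :
  open U -> (forall x, U x -> f x = g x) -> Ck k U f -> Ck k U g.
Proof.
move=> oU; elim: k f g => [|k IH] f g fg /=.
  move=> cf x Ux; rewrite /prop_for /continuous_at -(fg x Ux).
  apply: cvg_trans (cf x Ux); apply: near_eq_cvg.
  by apply: filterS (open_nbhs_nbhs (conj oU Ux)) => y /fg.
move=> [df Df].
have near_fg x : U x -> \near x, f x = g x.
  by move=> Ux; apply: filterS (open_nbhs_nbhs (conj oU Ux)) => y /fg.
split=> [x Ux|v].
  exact: near_eq_differentiable (near_fg x Ux) (df x Ux).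
by apply: IH (Df v) => x Ux; exact/near_eq_derive/near_fg.
Qed.

Lemma CkW V W k (U : set V) (f : V -> W) : Ck k.+1 U f -> Ck k U f.
Proof.
elim: k f => [|k IH] f [df Df]; first by move=> x /df/differentiable_continuous.
by split=> // v; apply: IH.
Qed.

Lemma Ck_cst V W k (U : set V) (w : W) : Ck k U (cst w : V -> W).
Proof.
elim: k w => [|k IH] w /=; first by move=> x _; exact: cvg_cst.
split=> [x _|v]; first exact: differentiable_cst.
rewrite (_ : 'D_v _ = cst 0); first exact: IH.
by apply/funext => x; rewrite derive_cst.
Qed.

Lemma Ck_add V W k (U : set V) (f g : V -> W) :
  open U -> Ck k U f -> Ck k U g -> Ck k U (f + g).
Proof.
move=> oU; elim: k f g => [|k IH] f g.
  by move=> cf cg x Ux; apply: cvgD; [exact: cf|exact: cg].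
move=> [df Df] [dg Dg]; split=> [x Ux|v].
  by apply: differentiableD; [exact: df|exact: dg].
apply: Ck_eq_on (IH _ _ (Df v) (Dg v)) => // x Ux.
by rewrite deriveD //; apply: diff_derivable; [exact: df|exact: dg].
Qed.

(** A continuous linear map is its own differential, so it commutes with the
    directional derivatives. *)
Lemma Ck_linear V W W' k (U : set V) (f : V -> W) (L : {linear W -> W'}) :
  open U -> continuous L -> Ck k U f -> Ck k U (L \o f).
Proof.
move=> oU cL; elim: k f => [|k IH] f.
  by move=> cf x Ux; apply: continuous_comp; [exact: cf|exact: cL].
move=> [df Df].
have dL y : differentiable L y by exact: linear_differentiable.
split=> [x Ux|v].
  by apply: differentiable_comp; [exact: df|exact: dL].
apply: Ck_eq_on (IH _ (Df v)) => // x Ux; have dfx := df x Ux.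
have dLf : differentiable (L \o f) x by exact: differentiable_comp.
by rewrite (deriveE v dLf) (diff_comp dfx (dL _)) /= (diff_lin _ cL) (deriveE v dfx).
Qed.

(** The Leibniz rule involves [f] and [g] themselves next to their derivatives,
    so the induction hypothesis is applied to them after lowering their order by
    [CkW]. *)
Lemma Ck_mul V k (U : set V) (f g : V -> R) :
  open U -> Ck k U f -> Ck k U g -> Ck k U (f * g).
Proof.
move=> oU; elim: k f g => [|k IH] f g.
  by move=> cf cg x Ux; apply: cvgM; [exact: cf|exact: cg].
move=> Cf Cg; have [[df Df] [dg Dg]] := (Cf, Cg); split=> [x Ux|v].
  by apply: differentiableM; [exact: df|exact: dg].
apply: (@Ck_eq_on _ _ _ _ (f * 'D_v g + g * 'D_v f)) => //.
  move=> x Ux; rewrite deriveM //; apply: diff_derivable; [exact: df|exact: dg].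
apply: Ck_add => //.
  by apply: IH; [exact: CkW|exact: Dg].
by apply: IH; [exact: CkW|exact: Df].
Qed.

(** In [(1 / g)' = - g' * (1 / g) ^ 2] the right-hand side contains [1 / g] only
    undifferentiated, so the induction on the order closes. *)
Lemma Ck_inv V k (U : set V) (g : V -> R) :
  open U -> (forall x, U x -> g x != 0) -> Ck k U g ->
  Ck k U (fun x => (g x)^-1).
Proof.
move=> oU g0; elim: k => [|k IH].
  by move=> cg x Ux; apply: cvgV; [exact: g0|exact: cg].
move=> Cg; have [dg Dg] := Cg; split=> [x Ux|v].
  by apply: differentiableV; [exact: dg|exact: g0].
pose h : V -> R := fun x => (g x)^-1.
apply: (@Ck_eq_on _ _ _ _ (cst (-1) * (h * h * 'D_v g))) => //.
  move=> x Ux; rewrite deriveV ?g0//; last exact/diff_derivable/dg.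
  by rewrite !fctE mulN1r /h -expr2 -exprVn -mulNr.
have Ch : Ck k U h by exact/IH/CkW.
apply: Ck_mul => //; first exact: Ck_cst.
by apply: Ck_mul; [|exact: Ck_mul|exact: Dg].
Qed.

End CkCalculus.

(** * The Minkowski product *)

Section Minkowski.
Context {R : realType}.
Implicit Types u v w : 'rV[R]_4.

Lemma minkC u v : mink u v = mink v u.
Proof.
rewrite /mink mulrC; congr (_ + _).
by apply: eq_bigr => i _; rewrite mulrC.
Qed.

Lemma mink_linear_l w : linear (fun u => mink u w : R).
Proof.
move=> k u v; rewrite /mink !mxE scalerDr mulrDl opprD -mulrA.
rewrite addrACA -mulrN; congr (_ + _).
under eq_bigr do rewrite !mxE mulrDl -mulrA.
by rewrite big_split /= -mulr_sumr.
Qed.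

Lemma minkDl u v w : mink (u + v) w = mink u w + mink v w.
Proof. by have := mink_linear_l w 1 u v; rewrite !scale1r. Qed.

Lemma minkZl (k : R) u w : mink (k *: u) w = k * mink u w.
Proof.
have mink0 : mink 0 w = 0.
  by have := minkDl 0 0 w; rewrite addr0 -[LHS]addr0 => /addrI.
by have := mink_linear_l w k u 0; rewrite !addr0 mink0 addr0.
Qed.

Lemma minkDr u v w : mink w (u + v) = mink w u + mink w v.
Proof. by rewrite minkC minkDl !(minkC w). Qed.

Lemma minkZr (k : R) u w : mink w (k *: u) = k * mink w u.
Proof. by rewrite minkC minkZl (minkC w). Qed.

Lemma continuous_mink_l w : continuous (fun u => mink u w : R).
Proof.
move=> u.
pose f (i : 'I_4) (v : 'rV[R]_4) : R := v 0 i * w 0 i.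
have df i : differentiable (f i) u.
  by apply: differentiableM; [exact: differentiable_coord
                             |exact: differentiable_cst].
apply: differentiable_continuous.
(* Padding with zero summands turns the sum over nonzero indices into a sum over
   all of ['I_4]. *)
have -> : (fun v : 'rV[R]_4 => mink v w : R) =
    - f 0 + \sum_(i < 4) (if i != 0 then f i else cst 0).
  by rewrite -big_mkcond fct_sumE; apply/funext => v.
apply: differentiableD; first exact/differentiableN.
apply: differentiable_sum => i.
by case: ifP => _; [exact: df|exact: differentiable_cst].
Qed.

Lemma smooth_mink_l (U : set R) (f : R -> 'rV[R]_4) w :
  open U -> smooth U f -> smooth U (fun s => mink (f s) w : R).
Proof.
move=> oU sf k.
pose mlM := GRing.isLinear.Build _ _ _ _ _ (mink_linear_l w).
pose mL : {linear 'rV[R]_4 -> R} := HB.pack (fun u => mink u w : R) mlM.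
exact: (Ck_linear (L := mL) oU (@continuous_mink_l w) (sf k)).
Qed.

End Minkowski.

(** * Components of a vector in a Darboux frame *)

Section Frame.
Context {R : realType} (M : set 'rV[R]_4) (I : set R).
Context (alpha zeta e eta : R -> 'rV[R]_4) (eps1 : R).
Hypothesis frame : darboux_frame M I alpha zeta e eta eps1.
Context (W : 'rV[R]_4) (s a b c d : R).
Hypothesis Is : I s.
Hypothesis WE : W = a *: derive1 alpha s + b *: zeta s + c *: e s + d *: eta s.

Lemma mink_T_frame : mink (derive1 alpha s) W = eps1 * b.
Proof.
have [TT _] := darboux_null frame Is; have [Te Tn _ _ _] := darboux_orth frame Is.
rewrite WE !minkDr !minkZr TT Te Tn (darboux_T_zeta frame Is).
by rewrite !mulr0 add0r !addr0 mulrC.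
Qed.

Lemma mink_e_frame : mink (e s) W = c.
Proof.
have [ee _] := darboux_unit frame Is.
have [Te _ ze _ en] := darboux_orth frame Is.
rewrite WE !minkDr !minkZr (minkC _ (derive1 _ _)) (minkC _ (zeta s)).
by rewrite Te ze ee en !mulr0 !add0r addr0 mulr1.
Qed.

Lemma mink_generalized_normal (l1 l2 : R -> R) :
  mink (generalized_normal alpha e eta l1 l2 s) W =
  mink (eta s) W + eps1 * b * l1 s + c * l2 s.
Proof.
rewrite !minkDl !minkZl mink_T_frame mink_e_frame.
by rewrite (mulrC (l1 s)) (mulrC (l2 s)).
Qed.

End Frame.

Theorem theorem14 (R : realType) (I : set R) (M : set 'rV[R]_4)
    (alpha zeta e eta : R -> 'rV[R]_4) (eps1 : R)
    (W : 'rV[R]_4) (a b c d : R -> R)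
    (hI : open_interval I)
    (hM : timelike_hypersurface M)
    (halpha : null_cartan_curve I alpha)
    (halphaM : forall s, I s -> M (alpha s))
    (hframe : darboux_frame M I alpha zeta e eta eps1)
    (hW : forall s, I s ->
       W = a s *: derive1 alpha s + b s *: zeta s + c s *: e s + d s *: eta s) :
  [/\ forall l1 l2 : R -> R,
        normal_silhouette I alpha e eta l1 l2 W <->
        (forall s, I s ->
           mink (eta s) W + eps1 * b s * l1 s + c s * l2 s = 0),
      forall s, I s -> c s != 0 ->
        exists x1 x2 : R, mink (eta s) W + eps1 * b s * x1 + c s * x2 = 0
    & (forall s, I s -> c s != 0) ->
        exists l1 l2 : R -> R,
          [/\ smooth I l1, smooth I l2
            & normal_silhouette I alpha e eta l1 l2 W]].
Proof.
have [oI _ _] := hI; have [_ se seta] := darboux_smooth hframe.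
have silhouetteE l1 l2 s : I s ->
    mink (generalized_normal alpha e eta l1 l2 s) W =
    mink (eta s) W + eps1 * b s * l1 s + c s * l2 s.
  by move=> Is; exact: (mink_generalized_normal hframe Is (hW s Is)).
split=> [l1 l2|s _ c0|c0].
- by split=> h s Is; have := h s Is; rewrite silhouetteE.
- exists 0, (- mink (eta s) W / c s).
  by rewrite mulr0 addr0 mulrCA divff // mulr1 subrr.
(* The coefficient [c] is replaced by [mink e W], whose smoothness is known. *)
pose n : R -> R := fun s => mink (eta s) W.
pose g : R -> R := fun s => mink (e s) W.
have gE s : I s -> g s = c s.
  by move=> Is; exact: (mink_e_frame hframe Is (hW s Is)).
exists (cst 0), (cst (-1) * (n * (fun s => (g s)^-1))); split.
- by move=> k; exact: Ck_cst.
- move=> k; apply: Ck_mul => //; first exact: Ck_cst.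
  apply: Ck_mul => //; first exact: smooth_mink_l seta k.
  apply: Ck_inv => //; last exact: smooth_mink_l se k.
  by move=> s Is; rewrite gE ?c0.
move=> s Is; rewrite silhouetteE // !fctE /= gE // mulr0 addr0.
by rewrite mulN1r mulrN mulrCA divff ?c0 // mulr1 subrr.
Qed.
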